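(* For any $2\le k\le n-1$, the knowledge of the fundamental matrix $\mathbf F_k$ of order $k$ of a pair of projections $(\pi_1,\pi_2)$ of $\mathbb P^n$ with distinct centers allows the computation of the projections modulo the action $\varrho$ of $\mathbb PGL_{n+1}(\mathbb C)$; that is, $\mathbf F_k$ determines the orbit under $\varrho$ of the pair of projection matrices $(\mathbf M_1,\mathbf M_2)$.
   Context: Everything is over $\mathbb C$. A projection $\pi_j:\mathbb P^n\setminus\{\mathbf O_j\}\to i_j(\mathbb P^{n-1})$ from a point $\mathbf O_j$ (the center) onto an embedded hyperplane is presented, once bases are fixed, by a full-rank $n\times(n+1)$ matrix $\mathbf M_j$, defined up to non-zero scalar, with kernel $\mathbf O_j$. The action $\varrho$ of $\mathbf A\in\mathbb PGL_{n+1}(\mathbb C)$ on pairs of projection matrices (up to scalars) is $(\mathbf M_1,\mathbf M_2)\mapsto(\mathbf M_1\mathbf A^{-1},\mathbf M_2\mathbf A^{-1})$. The centers $\mathbf O_1\ne\mathbf O_2$ are distinct, and the epipoles are $\mathbf e_1=\pi_1(\mathbf O_2)$ and $\mathbf e_2=\pi_2(\mathbf O_1)$. For $2\le k\le n-1$ the fundamental matrix of order $k$, $\mathbf F_k$, of $(\pi_1,\pi_2)$ is the matrix, defined up to non-zero scalar and of size $\binom{n}{n-k+1}\times\binom{n}{n-k}$, of the linear map $\wedge^{n-k}\mathbb C^n\to\wedge^{n-k+1}\mathbb C^n$ that sends an extensor (decomposable element) representing an $(n-1-k)$-plane $W\subset i_1(\mathbb P^{n-1})$ not containing $\mathbf e_1$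 to an extensor representing the $(n-k)$-plane $\pi_2(\pi_1^{-1}(W))$ of $i_2(\mathbb P^{n-1})$. *)

(* Defs.v *)
From HB Require Import structures.
From mathcomp Require Import all_boot all_order all_algebra.
From mathcomp Require Import complex.
From mathcomp Require Import reals.

Set Implicit Arguments.
Unset Strict Implicit.
Unset Printing Implicit Defensive.

Import Order.TTheory GRing.Theory Num.Theory.
Local Open Scope ring_scope.

(* Equality up to a non-zero scalar. *)
Definition proj_eq (F : fieldType) (m n : nat) (A B : 'M[F]_(m, n)) : Prop :=
  exists2 c : F, c != 0 & B = c *: A.

Section Exterior.
Variable F : fieldType.

(* The increasing p-tuples of indices below n number the coordinates of
   the p-th exterior power of F^n. *)
Definition wedge_index (n p : nat) (i : 'I_'C(n, p)) : p.-tuple 'I_n :=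
  enum_val (cast_ord (esym (card_ltn_sorted_tuples p n)) i).

(* v_0 /\ ... /\ v_{p-1}; its coordinates are the p x p minors of the matrix
   with columns v_0, ..., v_{p-1}. *)
Definition extensor (n p : nat) (v : p.-tuple 'cV[F]_n) : 'cV[F]_('C(n, p)) :=
  \col_i \det (\matrix_(a < p, b < p)
                 tnth v b (tnth (wedge_index i) a) ord0).

(* x is an extensor representing the projective plane attached to U, of
   projective dimension p - 1. *)
Definition represents (n p : nat) (U : {vspace 'cV[F]_n})
    (x : 'cV[F]_('C(n, p))) : Prop :=
  exists2 v : p.-tuple 'cV[F]_n, basis_of U v & x = extensor v.

End Exterior.

(* A plane of projective dimension d is encoded by the vector subspace of
   dimension d + 1 lying over it. *)
Section Projections.
Variables (F : fieldType) (n : nat).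

Definition proj_map (M : 'M[F]_(n, n.+1)) : 'Hom('cV[F]_n.+1, 'cV[F]_n) :=
  linfun (mulmx M).

Definition center (M : 'M[F]_(n, n.+1)) : {vspace 'cV[F]_n.+1} :=
  lker (proj_map M).

(* The image under M of the center of N. *)
Definition epipole (M N : 'M[F]_(n, n.+1)) : {vspace 'cV[F]_n} :=
  (proj_map M @: center N)%VS.

Definition projection_pair (M1 M2 : 'M[F]_(n, n.+1)) : Prop :=
  [/\ \rank M1 = n, \rank M2 = n & center M1 != center M2].

(* The linear preimage of W contains the center of M1, so it is the closure
   of the preimage of W under the projection, which is undefined there. *)
Definition transfer (M1 M2 : 'M[F]_(n, n.+1)) (W : {vspace 'cV[F]_n}) :
    {vspace 'cV[F]_n} :=
  (proj_map M2 @: (proj_map M1 @^-1: W))%VS.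

Definition is_fundamental_matrix (k : nat) (M1 M2 : 'M[F]_(n, n.+1))
    (Fk : 'M[F]_('C(n, n - k + 1), 'C(n, n - k))) : Prop :=
  forall W : {vspace 'cV[F]_n},
    \dim W = (n - k)%N -> ~~ (epipole M1 M2 <= W)%VS ->
    forall x : 'cV[F]_('C(n, n - k)),
      represents W x -> represents (transfer M1 M2 W) (Fk *m x).

(* (N1, N2) lies in the orbit of (M1, M2), as pairs of matrices each taken up
   to a non-zero scalar. *)
Definition same_orbit (M1 M2 N1 N2 : 'M[F]_(n, n.+1)) : Prop :=
  exists2 A : 'M[F]_n.+1, A \in unitmx &
    proj_eq (M1 *m invmx A) N1 /\ proj_eq (M2 *m invmx A) N2.

End Projections.

(* Main.v *)
Require Import Defs.
From mathcomp Require Import all_boot all_order all_fingroup all_algebra.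
From mathcomp Require Import complex.
From mathcomp Require Import reals ring.

(** An extensor determines its subspace (Cramer's rule recovers a reduced basis
    from the maximal minors), so proportional fundamental matrices give the same
    transfer [W |-> M2 (M1^-1 W)] for every [W] of dimension [p = n - k] avoiding
    both epipoles. As [p <= n - 2], letting [W] vary among the subspaces through
    [M1 v], for [v] generic, yields [u] and a scalar [c] with [N1 u = c M1 v] and
    [N2 u = M2 v]. If [Q1 x + Q2 y = 0] are equations of the image of [(N1, N2)],
    this says that [Q2 M2 v] is a multiple of [Q1 M1 v]. This holds generically,
    hence everywhere, and [Q1 M1] has rank at least [2], so the multiple does not
    depend on [v]: the image of [(N1, N2)] is that of [(M1, M2)] up to scaling
    the two factors. *)

Set Implicit Arguments.
Unset Strict Implicit.
Unset Printing Implicit Defensive.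

Import Order.TTheory GRing.Theory Num.Theory.

Local Open Scope ring_scope.

(** * Maximal minors, and recovery of a subspace from its extensor *)

Section Extensors.
Variables (F : fieldType) (n p : nat).
Implicit Types v w : p.-tuple 'cV[F]_n.

Definition coordmx v : 'M[F]_(n, p) := \matrix_(i, b) tnth v b i ord0.

Lemma wedge_index_surj (t : p.-tuple 'I_n) :
  sorted ltn (map val t) -> exists i, wedge_index i = t.
Proof.
move=> st; set S := [set u : p.-tuple 'I_n | sorted ltn (map val u)].
have tS : t \in S by rewrite inE.
exists (cast_ord (card_ltn_sorted_tuples p n) (enum_rank_in tS t)).
by rewrite /wedge_index cast_ordK enum_rankK_in.
Qed.

(** Coordinates of an extensor only give minors with increasing rows, whereas Cramer's rule replaces
    a row and breaks the order. A repeated row makes both sides zero; otherwise sorting the rows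
    costs the same sign on both sides. *)
Lemma minor_prop (c : F) v w : extensor w = c *: extensor v ->
  forall f : 'I_p -> 'I_n,
    \det (rowsub f (coordmx w)) = c * \det (rowsub f (coordmx v)).
Proof.
move=> vw f; case: (boolP (injectiveb f)) => [/injectiveP injf|]; last first.
  case/injectivePn=> a [b ab fab].
  by rewrite !(determinant_alternate ab) ?mulr0 // => j; rewrite !mxE fab.
pose t0 := [tuple f a | a < p].
pose t := sort_tuple (relpre val leq) t0.
have ut0 : uniq t0 by rewrite map_inj_uniq ?enum_uniq.
have st : sorted ltn (map val t).
  rewrite ltn_sorted_uniq_leq (map_inj_uniq val_inj) sort_uniq ut0 /=.
  by rewrite sorted_map sort_sorted // => i j; apply: leq_total.
have /tuple_permP[s ts] : perm_eq t0 t by rewrite perm_sym perm_sort.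
have fE a : f a = tnth t (s a).
  have /(congr1 (fun u => tnth u a)) : t0 = [tuple tnth t (s i) | i < p].
    exact: val_inj.
  by rewrite !tnth_mktuple.
have detf X : \det (rowsub f X) = (-1) ^+ s * \det (rowsub (tnth t) X) :> F.
  rewrite -det_perm -det_mulmx -row_permE; congr (\det _).
  by apply/matrixP=> a b; rewrite !mxE fE.
have [i it] := wedge_index_surj st.
have rsE (u : p.-tuple 'cV[F]_n) : \matrix_(a < p, b < p) tnth u b (tnth t a) ord0 =
    rowsub (tnth t) (coordmx u).
  by apply/matrixP=> a b; rewrite !mxE.
move/matrixP: vw => /(_ i ord0); rewrite !mxE it !rsE !detf => ->.
by rewrite mulrCA.
Qed.

(** The product [X *m invmx (rowsub f X)] is the basis of the column space reduced to the identity
    on the rows [f]; its entries are thus ratios of maximal minors. *)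
Lemma cramer_replace_row (X : 'M[F]_(n, p)) (f : 'I_p -> 'I_n) i j :
  rowsub f X \in unitmx ->
  \det (rowsub (fun a => if a == j then i else f a) X) =
  (X *m invmx (rowsub f X)) i j * \det (rowsub f X).
Proof.
move=> Xf; set Y := X *m _.
have YX : X = Y *m rowsub f X by rewrite mulmxKV.
have Yf : rowsub f Y = 1%:M by rewrite -mul_rowsub_mx mulmxV.
rewrite [in LHS]YX -mul_rowsub_mx det_mulmx; congr (_ * _).
set Z := rowsub _ Y.
have ZE a b : Z a b = if a == j then Y i b else (a == b)%:R.
  rewrite mxE; case: eqP => // _.
  by have /matrixP/(_ a b) := Yf; rewrite !mxE.
(* [Z] is the identity with row [j] replaced by row [i] of [Y], so column [j] has a single possibly
   non-zero entry, on the diagonal. *)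
rewrite (expand_det_col Z j) (bigD1 j) //= big1 => [|a aj]; last first.
  by rewrite ZE (negPf aj) mul0r.
rewrite addr0 ZE eqxx /cofactor addnn -signr_odd odd_double mul1r.
rewrite (_ : row' j (col' j Z) = 1%:M) ?det1 ?mulr1 //.
apply/matrixP=> a b; rewrite mxE mxE ZE eq_sym (negPf (neq_lift _ _)) mxE.
by rewrite (inj_eq lift_inj).
Qed.

Lemma row_full_coordmx v : free v -> row_full (coordmx v).
Proof.
move=> /freeP fv; rewrite /row_full -mxrank_tr -[_ == p]/(row_free _).
apply: inj_row_free=> u uX.
apply/rowP=> b; rewrite [RHS]mxE.
apply: (fv (fun a => u ord0 a) _ b); apply/colP=> i.
move/rowP: uX => /(_ i); rewrite !mxE summxE => uX; rewrite -[RHS]uX.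
by apply: eq_bigr => a _; rewrite !mxE (tnth_nth 0) !ord1.
Qed.

Lemma represents_exists (U : {vspace 'cV[F]_n}) :
  \dim U = p -> exists x : 'cV[F]_('C(n, p)), represents U x.
Proof.
move=> <-; exists (extensor (vbasis U)); exists (vbasis U) => //.
exact: vbasisP.
Qed.

Lemma represents_inj (U U' : {vspace 'cV[F]_n}) (c : F) (x : 'cV[F]_('C(n, p))) :
  c != 0 -> represents U x -> represents U' (c *: x) -> U = U'.
Proof.
move=> c0 [v bv ->] [w bw /esym/minor_prop vw].
have fv := row_full_coordmx (basis_free bv).
pose f : 'I_p -> 'I_n := fullrankfun fv.
have Xf : rowsub f (coordmx v) \in unitmx by apply: fullrowsub_unit.
have detXf : \det (rowsub f (coordmx v)) != 0 by rewrite -unitfE -unitmxE.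
have Yf : rowsub f (coordmx w) \in unitmx.
  by rewrite unitmxE unitfE vw mulf_neq0.
(* Both reduced bases have the same entries, since the factor [c] cancels in the ratios of
   minors. *)
have XY : coordmx v *m invmx (rowsub f (coordmx v)) =
          coordmx w *m invmx (rowsub f (coordmx w)).
  apply/matrixP=> i j.
  have := vw (fun a => if a == j then i else f a).
  rewrite !cramer_replace_row // vw !mulrA [_ * c]mulrC -!mulrA.
  by move/(mulfI c0)/(mulIf detXf).
have {XY} wE : coordmx w =
    coordmx v *m (invmx (rowsub f (coordmx v)) *m rowsub f (coordmx w)).
  by rewrite mulmxA XY mulmxKV.
set D := invmx _ *m _ in wE.
have wv b : tnth w b = \sum_a D a b *: tnth v a.
  apply/colP=> i; move/matrixP: wE => /(_ i b); rewrite !mxE summxE => ->.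
  by apply: eq_bigr => a _; rewrite !mxE mulrC.
have UU : (U' <= U)%VS.
  rewrite -(span_basis bv) -(span_basis bw); apply/span_subvP=> _ /tnthP[b ->].
  rewrite wv memv_suml // => a _; apply/memvZ/memv_span/mem_tnth.
apply/esym/eqP; rewrite eqEdim UU.
by rewrite (size_basis bv) (size_basis bw) leqnn.
Qed.
End Extensors.

(** * Subspaces avoiding two given subspaces *)

Section Avoidance.
Variables (K : fieldType) (vT : vectType K).
Implicit Types U V W : {vspace vT}.

(** Take [u] outside [U] and [v] outside [V]: if neither works, then [u] is in [V] and [v] in [U],
    so [u + v] escapes both. No assumption on the size of the field is involved. *)
Lemma notin_proper2 U V : U != fullv -> V != fullv ->
  exists w, (w \notin U) && (w \notin V).
Proof.
have out X : X != fullv -> exists2 w, w \in fullv & w \notin X :> bool.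
  by move=> Xf; apply/subvPn; rewrite eqEsubv subvf in Xf.
move=> /out[u _ uU] /out[v _ vV].
have [uV|] := boolP (u \in V); last by exists u; rewrite uU.
have [vU|] := boolP (v \in U); last by exists v; rewrite vV andbT.
exists (u + v); rewrite -[in X in X && _](memvN U (u + v)).
by rewrite memvN rpredDr // rpredDl // uU.
Qed.

Lemma cap_line0 U (x : vT) : x \notin U -> (<[x]> :&: U = 0)%VS.
Proof.
move=> xU; apply/eqP; rewrite -subv0; apply/subvP=> y.
rewrite memv_cap memv0 => /andP[/vlineP[c ->]].
by rewrite rpredZeq (negPf xU) orbF => /eqP->; rewrite scale0r.
Qed.

Lemma cap_addv_line0 W U (w : vT) :
  (W :&: U = 0)%VS -> w \notin (W + U)%VS -> ((W + <[w]>) :&: U = 0)%VS.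
Proof.
move=> WU wWU; apply/eqP; rewrite -subv0; apply/subvP=> y.
rewrite memv_cap => /andP[/memv_addP[a aW [_ /vlineP[c ->] ->]]] yU.
have [c0|c0] := eqVneq c 0.
  by rewrite c0 scale0r addr0 in yU *; rewrite -WU memv_cap aW.
case/negP: wWU; rewrite -[w](scalerK c0) memvZ //.
by rewrite -[_ *: _](addKr a) memv_add ?memvN.
Qed.

(** Vectors are added one at a time, each outside [W' + U1] and [W' + U2], which the dimension
    bounds keep proper. *)
Lemma extend_avoiding W U1 U2 p :
  (W :&: U1 = 0)%VS -> (W :&: U2 = 0)%VS -> (\dim W <= p)%N ->
  (p + \dim U1 <= dim vT)%N -> (p + \dim U2 <= dim vT)%N ->
  exists W', [/\ (W <= W')%VS, \dim W' = p, (W' :&: U1 = 0)%VS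
               & (W' :&: U2 = 0)%VS].
Proof.
move=> WU1 WU2; elim: p => [|p IHp]; rewrite leq_eqVlt.
  by rewrite ltn0 orbF => /eqP dW _ _; exists W; split.
case/orP=> [/eqP dW _ _|dW p1 p2]; first by exists W; split.
have [//||W' [WW' dW' W1 W2]] := IHp dW; [exact: ltnW | exact: ltnW |].
have proper U : (p.+1 + \dim U <= dim vT)%N -> (W' :&: U = 0)%VS ->
    (W' + U)%VS != fullv.
  move=> pU WU; apply/eqP=> /(congr1 (fun V : {vspace vT} => \dim V)).
  by rewrite (dimv_disjoint_sum WU) dimvf dW' => e; rewrite addSn e ltnn in pU.
have [w /andP[w1 w2]] := notin_proper2 (proper _ p1 W1) (proper _ p2 W2).
exists (W' + <[w]>)%VS; split; rewrite ?cap_addv_line0 //.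
  exact: subv_trans WW' (addvSl _ _).
have wW' : w \notin W' by apply: contra w1; apply/subvP/addvSl.
rewrite addvC dimv_disjoint_sum ?cap_line0 // dW' dim_vline.
suff -> : w != 0 by [].
by apply: contraNneq wW' => ->; apply: mem0v.
Qed.
End Avoidance.

(** * Pointwise collinear linear maps *)

Section Collinear.
Variables (F : fieldType) (m l : nat).
Implicit Types (A B : 'M[F]_(m, l)) (u v w : 'cV[F]_l).

(* [A v] and [B v] are collinear iff their 2 x 2 minors vanish, i.e. iff
   [A v (B v)^T] is symmetric; this is quadratic in [v], so it suffices to test
   it at [v0], [v0 + v] and [v0 - v]. *)
Lemma collinear_generic A B (S : {vspace 'cV[F]_l}) :
  (2 : F) != 0 -> S != fullv ->
  (forall v, v \notin S -> A *m v *m (B *m v)^T = B *m v *m (A *m v)^T) ->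
  forall v, A *m v *m (B *m v)^T = B *m v *m (A *m v)^T.
Proof.
move=> two0 Sf col v; have [|vS] := boolP (v \in S); last exact: col.
move=> vS; have [v0 _ v0S] : exists2 w, w \in fullv & w \notin S :> bool.
  by apply/subvPn; rewrite eqEsubv subvf in Sf.
pose q u := A *m u *m (B *m u)^T - B *m u *m (A *m u)^T.
have q0 u : u \notin S -> q u = 0 by move=> /col; rewrite /q => ->; rewrite subrr.
have qE : q (v0 + v) + q (v0 - v) = 2 *: (q v0 + q v).
  rewrite /q !(mulmxDr, mulmxN).
  move: (A *m v0) (A *m v) (B *m v0) (B *m v) => a a' b b'.
  by apply/matrixP=> i j; rewrite !(mxE, big_ord1); ring.
have : 2 *: q v = 0.
  by rewrite -[q v]add0r -(q0 _ v0S) -qE !q0 ?addr0 ?rpredDr ?rpredN.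
by move/eqP; rewrite scaler_eq0 (negPf two0) subr_eq0 => /eqP.
Qed.

(** With [c] the ratio at [v0], [C = A - c B] kills [v0] and still sends [w] to a multiple of [B w]
    when [B w] is off the line of [B v0]. Comparing [w] with [w + v0] forces this multiple to
    vanish. *)
Lemma collinear_scale A B v0 u0 :
  (forall v, A *m v *m (B *m v)^T = B *m v *m (A *m v)^T) ->
  B *m v0 != 0 -> B *m u0 \notin <[B *m v0]>%VS ->
  exists c, A = c *: B.
Proof.
move=> col Bv0 Bu0.
have scal v : B *m v != 0 -> exists c, A *m v = c *: (B *m v).
  case/cV0Pn=> j Bj; exists ((A *m v) j 0 / (B *m v) j 0).
  apply/colP=> i; rewrite [RHS]mxE.
  move: (col v) Bj; move: (A *m v) (B *m v) => a b /matrixP/(_ i j).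
  rewrite !(mxE, big_ord1) => e bj; apply: (mulIf bj).
  by rewrite [LHS]e mulrAC divfK // mulrC.
have [c Ac] := scal _ Bv0; exists c; apply/eqP; rewrite -subr_eq0; apply/eqP.
set C := A - _.
have Cv0 : C *m v0 = 0 by rewrite mulmxBl Ac -scalemxAl subrr.
have Cout w : B *m w \notin <[B *m v0]>%VS -> C *m w = 0.
  move=> Bw.
  have nz u : B *m u \notin <[B *m v0]>%VS -> exists r, C *m u = r *: (B *m u).
    move=> Bu; have [|r Ar] := scal u.
      by apply: contraNneq Bu => ->; apply: mem0v.
    by exists (r - c); rewrite mulmxBl Ar -scalemxAl scalerBl.
  have [r Cw] := nz w Bw.
  have [|s] := nz (w + v0); first by rewrite mulmxDr rpredDr ?memv_line.
  rewrite !mulmxDr Cv0 addr0 Cw scalerDr => /eqP.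
  rewrite addrC -subr_eq -scalerBl => /eqP e.
  have [rs|rs] := eqVneq (r - s) 0.
    move/eqP: rs e; rewrite subr_eq0 => /eqP->; rewrite subrr scale0r.
    by move/esym/eqP; rewrite scaler_eq0 (negPf Bv0) orbF => /eqP->; rewrite scale0r.
  case/negP: Bw; rewrite -[B *m w](scalerK rs) memvZ // e memvZ ?memv_line //.
apply/matrixP=> i j.
suff C0 w : C *m w = 0.
  have := C0 (delta_mx j 0); rewrite -colE => /matrixP/(_ i 0).
  by rewrite !mxE.
have [Bw|] := boolP (B *m w \in <[B *m v0]>%VS); last exact: Cout.
(* Both [w + u0] and [u0] have images under [B] off the line of [B v0], so [C] kills their
   difference [w]. *)
rewrite -[w](addrK u0) mulmxBr !Cout ?subrr //.
by rewrite mulmxDr rpredDl.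
Qed.
End Collinear.

(** The equations are the cokernel of the stacked matrix. Allowing [q] columns lets them serve both
    for single vectors and for producing a whole matrix [D] at once. *)
Lemma column_space_equations (F : fieldType) (m n : nat) (N1 N2 : 'M[F]_(m, n)) :
  exists Q1 Q2 : 'M[F]_(m + m, m), forall q (X Y : 'M[F]_(m, q)),
    Q1 *m X + Q2 *m Y = 0 <-> exists2 D, N1 *m D = X & N2 *m D = Y.
Proof.
pose Q := (cokermx (col_mx N1 N2)^T)^T.
exists (lsubmx Q), (rsubmx Q) => q X Y.
rewrite -mul_row_col hsubmxK; split=> [QXY | [D <- <-]].
  have /submxP[D XY] : ((col_mx X Y)^T <= (col_mx N1 N2)^T)%MS.
    by rewrite submxE -[_^T *m _]trmxK trmx_mul trmxK QXY trmx0.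
  move/(congr1 trmx): XY; rewrite trmx_mul !trmxK mul_col_mx => /eq_col_mx[-> ->].
  by exists D^T.
by rewrite -mul_col_mx mulmxA -[Q *m _]trmxK trmx_mul trmxK mulmx_coker trmx0 mul0mx.
Qed.

Lemma dim_cV (F : fieldType) (n : nat) : dim 'cV[F]_n = n.
Proof. by rewrite dim_matrix -[RHS]muln1. Qed.

(** * Projections, epipoles and the transfer of planes *)

Section Projections.
Variables (F : fieldType) (n : nat).
Implicit Types (M N : 'M[F]_(n, n.+1)) (v u : 'cV[F]_n.+1) (W : {vspace 'cV[F]_n}).

Lemma proj_mapE M v : proj_map M v = M *m v.
Proof. by rewrite lfunE. Qed.

Lemma mem_center M v : (v \in center M) = (M *m v == 0).
Proof. by rewrite memv_ker proj_mapE. Qed.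

Lemma proj_surj M : \rank M = n -> forall y : 'cV_n, exists v, M *m v = y.
Proof.
move=> rM y; have /row_freeP[B MB] : row_free M by apply/eqP.
by exists (B *m y); rewrite mulmxA MB mul1mx.
Qed.

Lemma dim_center M : \rank M = n -> \dim (center M) = 1%N.
Proof.
move=> rM; have := limg_ker_dim (proj_map M) fullv; rewrite capfv.
have -> : limg (proj_map M) = fullv.
  apply/eqP; rewrite eqEsubv subvf; apply/subvP=> y _.
  by have [v <-] := proj_surj rM y; rewrite -proj_mapE memv_img ?memvf.
by rewrite !dimvf !dim_cV => e; apply/eqP; rewrite -(eqn_add2r n) e add1n.
Qed.

Lemma epipoleP M N (y : 'cV_n) :
  reflect (exists2 v, N *m v = 0 & y = M *m v) (y \in epipole M N).
Proof.
apply: (iffP memv_imgP) => -[v Nv ->]; exists v; rewrite ?proj_mapE //.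
  by apply/eqP; rewrite -mem_center.
by rewrite mem_center Nv.
Qed.

Lemma dim_epipole M N : \rank N = n -> (\dim (epipole M N) <= 1)%N.
Proof.
move=> /dim_center dN; rewrite -[leqRHS]dN.
by rewrite -[leqRHS](limg_ker_dim (proj_map M)) leq_addl.
Qed.

Lemma center_inj M1 M2 v : projection_pair M1 M2 ->
  M1 *m v = 0 -> M2 *m v = 0 -> v = 0.
Proof.
case=> r1 r2 /eqP c12 v1 v2; apply/eqP/negPn/negP=> v0; case: c12.
have line M : \rank M = n -> M *m v = 0 -> center M = <[v]>%VS.
  move=> rM Mv; apply/esym/eqP.
  by rewrite eqEdim dim_center // dim_vline v0 -memvE mem_center Mv eqxx.
by rewrite !line.
Qed.

Lemma epipole_neq0 M1 M2 : projection_pair M1 M2 -> epipole M1 M2 != 0%VS.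
Proof.
move=> M12; have [r1 r2 _] := M12; apply/eqP=> e0.
have c0 : center M2 = 0%VS.
  apply/eqP; rewrite -subv0; apply/subvP=> v; rewrite mem_center memv0.
  move/eqP=> v2; apply/eqP/(center_inj M12) => //; apply/eqP.
  by rewrite -memv0 -e0; apply/epipoleP; exists v.
by have := dim_center r2; rewrite c0 dimv0.
Qed.

Lemma transferP M1 M2 W (y : 'cV_n) :
  reflect (exists2 v, M1 *m v \in W & y = M2 *m v) (y \in transfer M1 M2 W).
Proof.
by apply: (iffP memv_imgP) => -[v Wv ->]; exists v;
  rewrite ?proj_mapE // -?memv_preim proj_mapE in Wv *.
Qed.

(* If [z = N1 u], where [N2 u = M2 v], were not in [<[x]> + epipole N1 N2], some
   [W] through [x = M1 v] would avoid [epipole N1 N2 + <[z]>], whereas [M2 v] in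
   [transfer N1 N2 W] puts [z] in [W + epipole N1 N2]. *)
Lemma correspondence_generic (p : nat) M1 M2 N1 N2 v :
  (0 < p)%N -> (p.+2 <= n)%N ->
  projection_pair M1 M2 -> projection_pair N1 N2 ->
  (forall W, \dim W = p -> ~~ (epipole M1 M2 <= W)%VS ->
     ~~ (epipole N1 N2 <= W)%VS -> transfer M1 M2 W = transfer N1 N2 W) ->
  M1 *m v \notin epipole M1 M2 -> M1 *m v \notin epipole N1 N2 ->
  exists c u, N1 *m u = c *: (M1 *m v) /\ N2 *m u = M2 *m v.
Proof.
move=> p0 pn hM hN tr vM vN; have [_ rM2 _] := hM; have [_ rN2 _] := hN.
set x := M1 *m v in vM vN *.
have [u uv] := proj_surj rN2 (M2 *m v); set z := N1 *m u.
have [|zout] := boolP (z \in <[x]> + epipole N1 N2)%VS.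
  case/memv_addP=> [_ /vlineP[c ->] [_ /epipoleP[o No ->]]] zE.
  exists c, (u - o); rewrite !mulmxBr No subr0 uv; split=> //.
  by rewrite -/z zE addrK.
(* As [U] has dimension at most 2, the bound [p.+2 <= n] leaves room for a [W] of dimension [p]
   avoiding it. *)
pose U := (epipole N1 N2 + <[z]>)%VS.
have dU : (\dim U <= 2)%N.
  rewrite (leq_trans (dimv_add_leqif _ _)) // -[2%N]/(1 + 1)%N.
  by rewrite leq_add ?dim_epipole // dim_vline leq_b1.
have xU : x \notin U.
  apply: contra zout => /memv_addP[e eN [_ /vlineP[c ->] xE]].
  have [c0|c0] := eqVneq c 0.
    by rewrite xE c0 scale0r addr0 eN in vN.
  rewrite -[z](scalerK c0) memvZ // -[_ *: _](addKr e) -xE addrC.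
  by rewrite memv_add ?memv_line ?memvN.
have dx : (\dim <[x]> <= p)%N by rewrite dim_vline (leq_trans (leq_b1 _)).
have [||W [xW dW WM WU]] :=
    extend_avoiding (cap_line0 vM) (cap_line0 xU) dx; rewrite ?dim_cV.
- by apply: leq_trans pn; rewrite -(addn2 p) leq_add2l (leq_trans (dim_epipole _ rM2)).
- by apply: leq_trans pn; rewrite -(addn2 p) leq_add2l.
have avoid E V : E != 0%VS -> (E <= V)%VS -> (W :&: V = 0)%VS -> ~~ (E <= W)%VS.
  move=> E0 EV WV; apply: contra E0 => EW; rewrite -subv0 -WV subv_cap EW //.
have /vspaceP/(_ (M2 *m v)) : transfer M1 M2 W = transfer N1 N2 W.
  apply: tr => //; first exact: avoid (epipole_neq0 hM) (subvv _) WM.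
  exact: avoid (epipole_neq0 hN) (addvSl _ _) WU.
have -> : M2 *m v \in transfer M1 M2 W.
  by apply/transferP; exists v => //; apply: subvP xW _ (memv_line _).
case/esym/transferP=> u' u'W u'E.
have eN : z - N1 *m u' \in epipole N1 N2.
  by apply/epipoleP; exists (u - u'); rewrite mulmxBr // uv u'E subrr.
have : N1 *m u' \in (W :&: U)%VS.
  rewrite memv_cap u'W -[N1 *m u'](subKr z) addrC.
  by rewrite memv_add ?memvN ?memv_line.
rewrite WU memv0 => /eqP z0; rewrite z0 subr0 in eN.
by case/negP: zout; apply: subvP eN; apply: addvSr.
Qed.

(** * Recovery of the pair of projections from its transfer *)

Lemma same_orbit_of_transfer (p : nat) M1 M2 N1 N2 :
  (2 : F) != 0 -> (0 < p)%N -> (p.+2 <= n)%N ->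
  projection_pair M1 M2 -> projection_pair N1 N2 ->
  (forall W, \dim W = p -> ~~ (epipole M1 M2 <= W)%VS ->
     ~~ (epipole N1 N2 <= W)%VS -> transfer M1 M2 W = transfer N1 N2 W) ->
  same_orbit M1 M2 N1 N2.
Proof.
move=> two0 p0 pn hM hN tr; have n3 : (2 < n)%N by apply: leq_ltn_trans pn.
have [rM1 rM2 _] := hM; have [rN1 rN2 _] := hN.
have [Q1 [Q2 Q12]] := column_space_equations N1 N2.
have small (V : {vspace 'cV[F]_n}) : (\dim V <= 2)%N -> exists y, y \notin V.
  move=> dV; have /subvPn[y _ yV] : ~~ (fullv <= V)%VS; last by exists y.
  by apply: contraL dV => /dimvS; rewrite dimvf dim_cV -ltnNge; apply: leq_trans.
pose S := (epipole M1 M2 + epipole N1 N2)%VS.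
have dS : (\dim S <= 2)%N.
  rewrite (leq_trans (dimv_add_leqif _ _)) // -[2%N]/(1 + 1)%N.
  by rewrite leq_add ?dim_epipole.
(* A solution with second component zero comes from the center of [N2]. Hence the kernel of [Q1] has
   dimension at most 1, and [y], [y'] below can be chosen with independent images under [Q1]. *)
have Q1ker y : Q1 *m y = 0 -> y \in epipole N1 N2.
  move=> Qy; have /Q12[D <- ND] : Q1 *m y + Q2 *m (0 : 'cV_n) = 0.
    by rewrite mulmx0 addr0.
  by apply/epipoleP; exists D.
have [c QM] : exists c, Q2 *m M2 = c *: (Q1 *m M1).
  have [y yS] := small _ dS; have [v0 v0y] := proj_surj rM1 y.
  have yN : y \notin epipole N1 N2 by apply: contra yS; apply/subvP/addvSr.
  have [|y' y'S] := small (epipole N1 N2 + <[y]>)%VS.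
    rewrite (leq_trans (dimv_add_leqif _ _)) // -[2%N]/(1 + 1)%N.
    by rewrite leq_add ?dim_epipole // dim_vline leq_b1.
  have [u0 u0y] := proj_surj rM1 y'.
  apply: (@collinear_scale _ _ _ _ _ v0 u0).
  - apply: (@collinear_generic _ _ _ _ _ (proj_map M1 @^-1: S)%VS two0).
      apply: contraNneq yS => Sf.
      by rewrite -v0y -proj_mapE memv_preim Sf memvf.
    (* Off the preimage of [S], the pair [(d M1 v, M2 v)] is [(N1 u, N2 u)], hence satisfies the
       equations. *)
    move=> v; rewrite -memv_preim proj_mapE => vS.
    have [||d [u [u1 u2]]] := correspondence_generic p0 pn hM hN tr (v := v).
    + by apply: contra vS; apply/subvP/addvSl.
    + by apply: contra vS; apply/subvP/addvSr.
    have QE : Q2 *m M2 *m v = - d *: (Q1 *m M1 *m v).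
      apply/eqP; rewrite scaleNr -addr_eq0 addrC -!mulmxA scalemxAr.
      by apply/eqP/Q12; exists u.
    by rewrite QE linearZ /= -scalemxAl -scalemxAr.
  - by rewrite -mulmxA v0y; apply: contraNneq yN => /Q1ker.
  - apply: contra y'S => /vlineP[d]; rewrite -!mulmxA v0y u0y => /eqP.
    rewrite -subr_eq0 scalemxAr -mulmxBr => /eqP/Q1ker e.
    by rewrite -[y'](subrK (d *: y)) memv_add // memvZ ?memv_line.
have [D N1D N2D] : exists2 D, N1 *m D = - c *: M1 & N2 *m D = M2.
  by apply/Q12; rewrite QM -scalemxAr scaleNr addNr.
(* If [c = 0], then [N1 D = 0], so the image of [M2 = N2 D] lies in [epipole N2 N1], of dimension at
   most 1, although [M2] is surjective. *)
have c0 : c != 0.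
  apply/eqP=> c0; rewrite c0 oppr0 scale0r in N1D.
  have [|y yE] := small (epipole N2 N1).
    by rewrite (leq_trans (dim_epipole _ rN1)).
  have [v vy] := proj_surj rM2 y; case/negP: yE; apply/epipoleP.
  by exists (D *m v); rewrite mulmxA ?N1D ?mul0mx // N2D.
(* A vector killed by [D] lies in both centers of [(M1, M2)], hence is zero. *)
have Du : D \in unitmx.
  rewrite -unitmx_tr -row_free_unit; apply: inj_row_free => w wD.
  have Dw : D *m w^T = 0 by rewrite -[D]trmxK -trmx_mul wD trmx0.
  apply: trmx_inj; rewrite trmx0; apply: (center_inj hM).
    apply: (scalerI (a := - c)); rewrite ?oppr_eq0 //.
    by rewrite scalemxAl -N1D -mulmxA Dw mulmx0 scaler0.
  by rewrite -N2D -mulmxA Dw mulmx0.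
exists D => //; split.
  by exists (- c); rewrite ?oppr_eq0 // scalemxAl -N1D mulmxK.
by exists 1; rewrite ?oner_eq0 // scale1r -N2D mulmxK.
Qed.

Lemma fundamental_matrix_same_orbit (k : nat) M1 M2 N1 N2
    (FM FN : 'M[F]_('C(n, n - k + 1), 'C(n, n - k))) :
  (2 : F) != 0 -> (2 <= k <= n - 1)%N ->
  projection_pair M1 M2 -> projection_pair N1 N2 ->
  is_fundamental_matrix M1 M2 FM -> is_fundamental_matrix N1 N2 FN ->
  proj_eq FM FN -> same_orbit M1 M2 N1 N2.
Proof.
move=> two0 hk hM hN hFM hFN [c c0 FNE].
have [k2 kn] : (2 <= k)%N /\ (k < n)%N.
  case/andP: hk => k2 kn; split=> //.
  by move: kn (leq_trans k2 kn); rewrite subn1; case: (n).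
(* Here [k < n] gives [0 < p], and [2 <= k] gives [p.+2 <= n]. *)
apply: (@same_orbit_of_transfer (n - k)) => //.
- by rewrite subn_gt0.
- by rewrite -addn2 -[leqRHS](subnK (ltnW kn)) leq_add2l.
move=> W dW WM WN; have [x Wx] := represents_exists dW.
(* The same extensor [x] of [W] is sent by [FM] and [FN] to proportional extensors, one for each
   transfer of [W]. *)
apply: represents_inj c0 (hFM W dW WM x Wx) _.
by rewrite scalemxAl -FNE; apply: hFN.
Qed.
End Projections.

Theorem corollary2p1 (R : realType) (n k : nat) (hk : (2 <= k <= n - 1)%N)
    (M1 M2 N1 N2 : 'M[R[i]]_(n, n.+1))
    (hM : projection_pair M1 M2) (hN : projection_pair N1 N2)
    (FM FN : 'M[R[i]]_('C(n, n - k + 1), 'C(n, n - k)))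
    (hFM : is_fundamental_matrix M1 M2 FM)
    (hFN : is_fundamental_matrix N1 N2 FN)
    (hF : proj_eq FM FN) :
  same_orbit M1 M2 N1 N2.
Proof.
have two0 : (2 : R[i]) != 0 by rewrite pnatr_eq0.
exact: fundamental_matrix_same_orbit two0 hk hM hN hFM hFN hF.
Qed.
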